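(* Let $T>0$. Suppose $a_\star\in\mathcal A$ and $\eta_\star\in(0,1)$ satisfy $$\sup_{a\in\mathcal A}\mathbb E_{\pi_1}\bigl[\phi(a,\cdot)^{\eta_\star}\bigr]=\mathbb E_{\pi_1}\bigl[\phi(a_\star,\cdot)^{\eta_\star}\bigr]=e^{1/T},$$ and suppose that $\phi(a_\star,\cdot)\le\Phi$ $\pi_1$-almost surely, for a constant $\Phi$. Then $$(\alpha/\Phi)^{\eta_\star}\le\mathbb E_{\pi_1^\otimes}\bigl[e^{-\tau^{a_\star}/T}\bigr]\le\sup_{a^\infty\text{ Markov}}\mathbb E_{\pi_1^\otimes}\bigl[e^{-\tau^{a^\infty}/T}\bigr]\le\alpha^{\eta_\star},$$ where $\tau^{a_\star}$ is the rejection time of the policy that always plays $a_\star$.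
   Context: Notation: $\mathbb R_+=[0,\infty)$, $\inf\emptyset=\infty$, $e^{-\infty/T}=0$. $\mathcal X$ is a standard Borel space, $\mathcal P_{\mathcal X}$ is the set of Borel probability measures on $\mathcal X$, $\mathcal P_0\subseteq\mathcal P_{\mathcal X}$ (the null hypothesis) and $\pi_1\in\mathcal P_{\mathcal X}\setminus\mathcal P_0$ (the simple alternative) are fixed. $\pi_1^\otimes$ is the infinite product measure on $\mathcal X^\infty$, the law of i.i.d. observations $x_1,x_2,\dots$ with law $\pi_1$. A level $\alpha\in(0,1)$ is fixed. Action space: $\mathcal A$ is a standard Borel space and $\phi:\mathcal A\times\mathcal X\to\mathbb R_+$ is a (jointly) Borel map satisfying $\int_{\mathcal X}\phi(a,x)\,\mathrm d\pi(x)\le 1$ for every $a\in\mathcal A$ and every $\pi\in\mathcal P_0$. A Markov policy is a sequence $a^\infty=(a_t)_{t\ge0}$ of Borel maps $a_t:[0,\alpha^{-1})\to\mathcal A$: after $t$ rounds have been played with current wealth $w<\alpha^{-1}$, it chooses the action $a_t(w)$ for the bet on $x_{t+1}$. The wealth starts from $W_0=1$ and evolves, until it first reaches $\alpha^{-1}$, by $W_{t+1}=W_t\,\phi(a_t(W_t),x_{t+1})$; the rejection time $\tau^{a^\infty}$ is the first $t\ge1$ with $W_t\ge\alpha^{-1}$ ($\infty$ if there is none). For $a\in\mathcal A$, $\tau^a$ is the rejection time under the constant policy $a_t\equiv a$, i.e. $\tau^a=\inf\{t\ge1:\prod_{k=1}^t\phi(a,x_k)\ge\alpha^{-1}\}$.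 *)

(* Defs.v *)
From HB Require Import structures.
From mathcomp Require Import all_boot all_order all_algebra.
From mathcomp Require Import all_classical all_reals all_analysis.

Set Implicit Arguments.
Unset Strict Implicit.
Unset Printing Implicit Defensive.

Import Order.TTheory GRing.Theory Num.Theory.
Import numFieldNormedType.Exports.

Local Open Scope classical_set_scope.
Local Open Scope ring_scope.

Definition polish (R : realType) (S : metricType R) : Prop :=
  (forall F : set_system S, ProperFilter F -> cauchy F -> exists l : S, F --> l) /\
  (exists2 D : set S, countable D & dense D).

(* The topology is not part of the structure of [T], hence the bijection [f] to
   a Polish space with its Borel sigma-algebra. *)
Definition standard_borel (R : realType) d (T : measurableType d) : Prop :=
  exists (S : metricType R) (f : T -> S),
    [/\ polish S, bijective f &
        @measurable _ T = [set f @^-1` B | B in <<s @open S >>]].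

Definition coord_sets d (X : measurableType d) : set (set (nat -> X)) :=
  [set C | exists (i : nat) (B : set X), measurable B /\ C = [set x | B (x i)]].

Definition seqspace d (X : measurableType d) :
    measurableType (@coord_sets d X).-sigma :=
  g_sigma_algebraType (@coord_sets d X).

(* The library has no infinite products of measures. [P] is the (unique)
   infinite product of copies of [pi] when it has the product values on all
   finite-dimensional measurable rectangles. *)
Definition is_product_law (R : realType) d (X : measurableType d)
    (pi : probability X R) (P : probability (seqspace X) R) : Prop :=
  forall (n : nat) (B : nat -> set X),
    (forall i, measurable (B i)) ->
    P [set x | forall i, (i < n)%N -> B i (x i)] =
    (\prod_(i < n) pi (B i))%E.

Section rejection.
Context (R : realType) d d' (A : measurableType d) (X : measurableType d').
Variables (alpha : R) (phi : A * X -> R).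

(* Only the restriction of [a t] to [0, alpha^-1) matters. *)
Definition markov_policy : set (nat -> R -> A) :=
  [set a | forall t, measurable_fun `[0, alpha^-1[ (a t)].

(* The sequence of observations is indexed from 0: [x t] is the observation of
   round t + 1. Wealth is frozen once it has reached [alpha^-1]. *)
Fixpoint wealth (a : nat -> R -> A) (x : nat -> X) (t : nat) : R :=
  if t is s.+1 then
    let w := wealth a x s in
    if w < alpha^-1 then w * phi (a s w, x s) else w
  else 1.

(* Equal to +oo if the wealth never reaches [alpha^-1]. *)
Definition rejection_time (a : nat -> R -> A) (x : nat -> X) : \bar R :=
  ereal_inf [set (t%:R)%:E | t in
    [set t : nat | (1 <= t)%N /\ alpha^-1 <= wealth a x t]].

Definition discounted_value (T : R) (P : probability (seqspace X) R)
    (a : nat -> R -> A) : \bar R :=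
  (\int[P]_x expeR (- (rejection_time a x * (T^-1)%:E)))%E.

End rejection.

Arguments markov_policy {R d} A alpha.

(* Main.v *)
Require Import Defs.
From HB Require Import structures.
From mathcomp Require Import all_boot all_order all_algebra.
From mathcomp Require Import all_classical all_reals all_analysis.
From mathcomp Require Import measurable_realfun.

(* Each round multiplies E[W^eta] by at most e^(1/T), with equality for the bet
   astar.  Hence (alpha w)^eta dominates the optimal expected discounted reward
   of an agent of wealth w < 1/alpha: it is at least 1 once w >= 1/alpha and it
   is a supersolution of the Bellman recursion.  For the constant policy astar,
   w^eta solves the recursion, and the wealth overshoots 1/alpha by a factor of
   at most Phi, so that (alpha w / Phi)^eta is a lower bound.  Both bounds are
   proved by induction on a finite horizon n, up to an error of order e^(-n/T)
   in the second one, and n then tends to infinity.  The recursion rests on the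
   product law being the law of (y, x) with y and x independent, distributed as
   one observation and as a whole sequence. *)

Set Implicit Arguments.
Unset Strict Implicit.

Import Order.TTheory GRing.Theory Num.Theory.
Import numFieldNormedType.Exports.

Local Open Scope classical_set_scope.
Local Open Scope ring_scope.

(** * Prepending and shifting in the sequence space *)

Definition scons d (X : measurableType d) (z : X * seqspace X) : seqspace X :=
  fun n => if n is m.+1 then z.2 m else z.1.

Definition stail d (X : measurableType d) (x : seqspace X) : seqspace X :=
  fun n => x n.+1.

Section seqspace_measurability.
Context {d} {X : measurableType d}.

Lemma measurable_coord (n : nat) :
  measurable_fun setT (fun x : seqspace X => x n).
Proof.
move=> _ B mB; rewrite setTI; apply: sub_sigma_algebra.
by exists n, B.
Qed.

Lemma measurable_fun_seqspace d' (Y : measurableType d') (f : Y -> seqspace X) :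
  (forall n, measurable_fun setT (fun y => f y n)) -> measurable_fun setT f.
Proof.
move=> mf.
apply: (@measurability _ _ Y (seqspace X) setT f (@coord_sets d X) erefl).
move=> _ [_ [n [B [mB ->]]] <-].
exact: mf.
Qed.

Lemma measurable_stail : measurable_fun setT (@stail d X).
Proof. by apply: measurable_fun_seqspace => n; exact: measurable_coord. Qed.

Lemma measurable_scons : measurable_fun setT (@scons d X).
Proof.
apply: measurable_fun_seqspace => -[|n]/=; first exact: measurable_fst.
by apply: (measurableT_comp (measurable_coord n)); exact: measurable_snd.
Qed.

End seqspace_measurability.

(** * Splitting off the first coordinate of a product law *)

Section product_law.
Context (R : realType) d (X : measurableType d).
Variables (pi : probability X R) (P : probability (seqspace X) R).
Hypothesis hP : is_product_law pi P.

(** These rectangles are closed under intersection and [hP] gives their [P]-measure, which is what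
    uniqueness of measures asks for. *)
Let cylinder : set (set (seqspace X)) :=
  [set C | exists (n : nat) (B : nat -> set X), (forall i, measurable (B i)) /\
    C = [set x | forall i, (i < n)%N -> B i (x i)]].

Lemma cylinder_measurable : cylinder `<=` measurable.
Proof.
move=> _ [n [B [mB ->]]].
rewrite (_ : mkset _ = \bigcap_(i < n) ((fun x : seqspace X => x i) @^-1` B i)).
  apply: bigcap_measurableType => i _.
  by rewrite -[X in measurable X]setTI; exact: measurable_coord.
by apply/seteqP; split => x.
Qed.

Lemma cylinder_setI : setI_closed cylinder.
Proof.
move=> _ _ [m [B [mB ->]]] [n [C [mC ->]]].
(* Each rectangle is padded with [setT] beyond its own length, up to the common length. *)
exists (maxn m n), (fun i => (if (i < m)%N then B i else setT) `&`
                    (if (i < n)%N then C i else setT)); split.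
  by move=> i; apply: measurableI; case: ifP.
apply/seteqP; split => x /=.
  by move=> [hB hC] i _; split; case: ifP => // ?; [exact: hB|exact: hC].
move=> h; split=> i im.
  by have := h i; rewrite leq_max im => /(_ isT)[].
by have := h i; rewrite leq_max im orbT => /(_ isT)[].
Qed.

Lemma generated_cylinder :
  @measurable _ (seqspace X) = <<s cylinder >>.
Proof.
apply/seteqP; split; last first.
  by apply: smallest_sub; [exact: sigma_algebra_measurable|
    exact: cylinder_measurable].
change (<<s @coord_sets d X >> `<=` <<s cylinder >>).
apply: smallest_sub; first exact: smallest_sigma_algebra.
move=> _ [i [B [mB ->]]].
apply: sub_sigma_algebra.
exists i.+1, (fun j => if j == i then B else setT); split.
  by move=> j; case: ifP.
apply/seteqP; split => x /=.
  by move=> Bxi j _; case: eqP => // ->.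
by move=> /(_ i (ltnSn _)); rewrite eqxx.
Qed.

(** Both measures agree on rectangles: the preimage under [scons] of a rectangle of length n+1 is
    [B 0] times the shifted rectangle of length n. Finiteness of [P] then extends the equality to
    the whole sigma-algebra. *)
Lemma product_law_scons (C : set (seqspace X)) : measurable C ->
  P C = pushforward (pi \x P)%E (@scons d X) C.
Proof.
pose mu : measure (seqspace X) R := pushforward (pi \x P)%E (@scons d X).
apply: (@measure_unique _ R (seqspace X) cylinder (fun _ => setT)
  generated_cylinder cylinder_setI _ _ P (mu measurable_scons)).
- move=> _; exists 0%N, (fun _ => setT); split => //.
  by apply/seteqP; split.
- by rewrite bigcup_const.
- move=> _ [n [B [mB ->]]]; rewrite /mu /pushforward/= hP//.
  case: n => [|n].
    rewrite big_ord0; transitivity ((pi \x P)%E (setT `*` setT)).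
      rewrite product_measure1E//.
      rewrite -[LHS]mule1; congr (_ * _)%E; symmetry.
        exact: (@probability_setT _ _ _ pi).
      exact: (@probability_setT _ _ _ P).
    by congr ((pi \x P)%E _); apply/seteqP; split.
  rewrite big_ord_recl/=; transitivity ((pi \x P)%E
      (B 0%N `*` [set x | forall i, (i < n)%N -> B i.+1 (x i)])).
    rewrite product_measure1E//; last first.
      by apply: cylinder_measurable; exists n, (fun i => B i.+1).
    congr (_ * _)%E; symmetry.
    exact: (@hP n (fun i => B i.+1) (fun i => mB i.+1)).
  congr ((pi \x P)%E _); apply/seteqP; split => -[y x] /=.
    by move=> [h0 h] [|i] ilt //=; exact: h.
  by move=> h; split => [|i ilt]; [exact: (h 0%N)|exact: (h i.+1)].
- move=> _.
  exact: le_lt_trans (@probability_le1 _ _ _ P _ measurableT) (ltry 1).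
Qed.

Lemma ge0_integral_product_law (f : seqspace X -> \bar R) :
  measurable_fun setT f -> (forall x, 0 <= f x)%E ->
  (\int[P]_x f x = \int[pi]_y \int[P]_x f (scons (y, x)))%E.
Proof.
move=> mf f0.
pose mu : measure (seqspace X) R := pushforward (pi \x P)%E (@scons d X).
rewrite (@eq_measure_integral _ _ _ setT (mu measurable_scons)); last first.
  by move=> C mC _; exact: product_law_scons.
rewrite /mu/= (ge0_integral_pushforward measurable_scons)//.
rewrite preimage_setT fubini_tonelli1//.
  exact: measurableT_comp mf measurable_scons.
by move=> x; exact: f0.
Qed.

End product_law.

(** * Finite-horizon values and their Bellman recursion *)

Section truncated_value.
Context (R : realType) d d' (A : measurableType d) (X : measurableType d').
Variables (alpha T : R) (phi : A * X -> R) (phi_ge0 : forall z, 0 <= phi z).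
Hypothesis phi_meas : measurable_fun setT phi.

(* Reward [e^(-k/T)] for reaching [alpha^-1] in [k <= n] further rounds, and 0
   if this does not happen; the wealth is [w] after [s] rounds, and [x] lists
   the observations still to come. *)
Fixpoint truncated_value (a : nat -> R -> A) (n s : nat) (w : R)
    (x : seqspace X) : R :=
  if alpha^-1 <= w then 1
  else if n is m.+1 then
    expR (- T^-1) *
      truncated_value a m s.+1 (w * phi (a s w, x 0%N)) (stail x)
  else 0.

Lemma truncated_value_hit a n s w x :
  alpha^-1 <= w -> truncated_value a n s w x = 1.
Proof. by case: n => [|n] /= ->. Qed.

Lemma truncated_value_ge0 a n s w x : 0 <= truncated_value a n s w x.
Proof.
elim: n s w x => [|n IHn] s w x /=; case: ifP => // _.
by rewrite mulr_ge0// expR_ge0.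
Qed.

(** Measurability must be joint in wealth and observations: after one round the wealth is itself a
    function of the first observation, and Tonelli is applied to the pair. *)
Lemma measurable_truncated_value a n s :
  (forall t, measurable_fun setT (a t)) ->
  measurable_fun setT
    (fun z : R * seqspace X => truncated_value a n s z.1 z.2).
Proof.
move=> ma; elim: n s => [|n IHn] s /=.
  by apply: measurable_fun_ifT => //; apply: measurable_fun_ler.
apply: measurable_fun_ifT => //; first exact: measurable_fun_ler.
apply: measurable_funM => //.
have mcoord : measurable_fun setT (fun z : R * seqspace X => z.2 0%N).
  by apply: (measurableT_comp (measurable_coord 0)); exact: measurable_snd.
apply: (measurableT_comp (IHn s.+1)
  (g := fun z : R * seqspace X => (z.1 * phi (a s z.1, z.2 0%N), stail z.2))).
apply: measurable_fun_pair; last first.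
  by apply: (measurableT_comp measurable_stail); exact: measurable_snd.
apply: measurable_funM => //.
apply: (measurableT_comp phi_meas
  (g := fun z : R * seqspace X => (a s z.1, z.2 0%N))).
apply: measurable_fun_pair => //.
by apply: (measurableT_comp (ma s)); exact: measurable_fst.
Qed.

Section expected_value.
Variables (pi : probability X R) (P : probability (seqspace X) R).
Hypothesis hP : is_product_law pi P.
Variable a : nat -> R -> A.
Hypothesis ma : forall t, measurable_fun setT (a t).

Definition expected_value (n s : nat) (w : R) : \bar R :=
  (\int[P]_x (truncated_value a n s w x)%:E)%E.

Lemma expected_value_ge0 n s w : (0 <= expected_value n s w)%E.
Proof.
by apply: integral_ge0 => x _; rewrite lee_fin truncated_value_ge0.
Qed.

Lemma measurable_expected_value n s :
  measurable_fun setT (expected_value n s).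
Proof.
apply: (@measurable_fun_fubini_tonelli_F _ _ _ _ _ P
  (fun z : R * seqspace X => (truncated_value a n s z.1 z.2)%:E)).
- by apply/measurable_EFinP; exact: measurable_truncated_value.
- by move=> z; rewrite lee_fin truncated_value_ge0.
Qed.

Lemma measurable_truncated_value_fix n s w :
  measurable_fun setT (fun x : seqspace X => truncated_value a n s w x).
Proof.
apply: (measurableT_comp (measurable_truncated_value n s ma)
  (g := fun x : seqspace X => (w, x))).
exact: pair1_measurable.
Qed.

Lemma expected_value_hit n s w : alpha^-1 <= w -> expected_value n s w = 1%E.
Proof.
move=> hw; rewrite /expected_value.
under eq_integral do rewrite truncated_value_hit//.
by rewrite integral_cst// mul1e; exact: (@probability_setT _ _ _ P).
Qed.

(** Bellman equation, by conditioning on the first observation [y]: it affects the future only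
    through the new wealth, and the shifted sequence again has law [P]. *)
Lemma expected_value_recr n s w : w < alpha^-1 ->
  expected_value n.+1 s w = ((expR (- T^-1))%:E *
    \int[pi]_y expected_value n s.+1 (w * phi (a s w, y)))%E.
Proof.
move=> hw; rewrite /expected_value (ge0_integral_product_law hP); last 2 first.
- by apply/measurable_EFinP; exact: measurable_truncated_value_fix.
- by move=> x; rewrite lee_fin truncated_value_ge0.
rewrite -ge0_integralZl_EFin ?expR_ge0//; last 2 first.
- by move=> y _; exact: expected_value_ge0.
- apply: (measurableT_comp (measurable_expected_value n s.+1)).
  apply: measurable_funM => //.
  apply: (measurableT_comp phi_meas (g := fun y => (a s w, y))).
  exact: pair1_measurable.
apply: eq_integral => y _.
rewrite -ge0_integralZl_EFin ?expR_ge0//; last 2 first.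
- by move=> x _; rewrite lee_fin truncated_value_ge0.
- by apply/measurable_EFinP; exact: measurable_truncated_value_fix.
by apply: eq_integral => x _ /=; rewrite leNgt hw/= EFinM.
Qed.

End expected_value.
End truncated_value.

(** * Upper and lower bounds on the finite-horizon values *)

Section exponential_moment_bounds.
Context (R : realType) d d' (A : measurableType d) (X : measurableType d').
Variables (alpha T : R) (alpha_gt0 : 0 < alpha).
Variables (phi : A * X -> R) (phi_ge0 : forall z, 0 <= phi z).
Hypothesis phi_meas : measurable_fun setT phi.
Variables (pi : probability X R) (P : probability (seqspace X) R).
Hypothesis hP : is_product_law pi P.
Variables (eta : R) (eta_gt0 : 0 < eta).

Let measurable_action (b : A) : measurable_fun setT (fun y => phi (b, y)).
Proof. by apply: (measurableT_comp phi_meas); exact: pair1_measurable. Qed.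

Lemma integral_scaled_moment (b : A) (c : R) : 0 <= c ->
  (\int[pi]_y ((c * phi (b, y)) `^ eta)%:E =
   (c `^ eta)%:E * \int[pi]_y (phi (b, y) `^ eta)%:E)%E.
Proof.
move=> c0; rewrite -ge0_integralZl_EFin ?powR_ge0//.
- by apply: eq_integral => y _; rewrite powRM// EFinM.
- by move=> y _; rewrite lee_fin powR_ge0.
- apply/measurable_EFinP.
  exact: (measurableT_comp (measurable_powR eta) (measurable_action b)).
Qed.

Let powR_hit (w : R) : 0 <= w -> alpha^-1 <= w -> 1 <= (alpha * w) `^ eta.
Proof.
move=> w0 hw; have -> : 1 = 1 `^ eta :> R by rewrite powR1.
rewrite ge0_ler_powR ?nnegrE ?mulr_ge0 ?(ltW alpha_gt0) ?(ltW eta_gt0)//.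
by rewrite -(divff (lt0r_neq0 alpha_gt0)) ler_pM2l.
Qed.

(** Induction on the horizon, for all [s] at once since the policy depends on time: a round
    multiplies the moment by at most e^(1/T), which the discount e^(-1/T) compensates. *)
Lemma expected_value_le (a : nat -> R -> A) (n s : nat) (w : R) :
  (forall t, measurable_fun setT (a t)) ->
  (forall b, \int[pi]_y (phi (b, y) `^ eta)%:E <= (expR T^-1)%:E)%E ->
  0 <= w -> (expected_value alpha T phi P a n s w <= ((alpha * w) `^ eta)%:E)%E.
Proof.
move=> ma moment; elim: n s w => [|n IHn] s w w0;
    have [hw|hw] := leP alpha^-1 w.
- by rewrite expected_value_hit// lee_fin powR_hit.
- rewrite /expected_value /=.
  under eq_integral do rewrite leNgt hw/=.
  by rewrite integral0 lee_fin powR_ge0.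
- by rewrite expected_value_hit// lee_fin powR_hit.
- rewrite (expected_value_recr T phi_meas hP)//.
  apply: (@le_trans _ _ ((expR (- T^-1))%:E *
      \int[pi]_y ((alpha * w * phi (a s w, y)) `^ eta)%:E)%E).
    apply: lee_wpmul2l; first by rewrite lee_fin expR_ge0.
    apply: ge0_le_integral => //.
    + by move=> y _; exact: expected_value_ge0.
    + apply: (measurableT_comp
        (measurable_expected_value alpha T phi_meas P ma n s.+1)).
      exact: measurable_funM.
    + apply/measurable_EFinP; apply: (measurableT_comp (measurable_powR eta)).
      exact: measurable_funM.
    + by move=> y _; rewrite -mulrA; apply: IHn; rewrite mulr_ge0.
  rewrite integral_scaled_moment ?mulr_ge0 ?(ltW alpha_gt0)// muleCA.
  (* The common factor (alpha w)^eta is removed; the rest is at most e^(-1/T) e^(1/T) = 1. *)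
  rewrite -[leRHS]mule1; apply: lee_wpmul2l; first by rewrite lee_fin powR_ge0.
  apply: (@le_trans _ _ ((expR (- T^-1))%:E * (expR T^-1)%:E)%E).
    by apply: lee_wpmul2l; rewrite ?lee_fin ?expR_ge0.
  by rewrite -EFinM -expRD addNr expR0.
Qed.

(** The invariant w <= Phi/alpha survives a round almost surely, because betting stops at 1/alpha.
    The last term accounts for the wealth still below 1/alpha when the horizon runs out, discounted
    once per round. *)
Lemma expected_value_ge (b : A) (Phi : R) (n s : nat) (w : R) :
  (\int[pi]_y (phi (b, y) `^ eta)%:E = (expR T^-1)%:E)%E ->
  {ae pi, forall y, phi (b, y) <= Phi} -> 0 <= w <= Phi / alpha ->
  ((w `^ eta)%:E <= ((Phi / alpha) `^ eta)%:E *
    expected_value alpha T phi P (fun _ _ => b) n s w +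
    ((alpha^-1 `^ eta) * expR (- T^-1) ^+ n)%:E)%E.
Proof.
move=> moment hPhi; elim: n s w => [|n IHn] s w /andP[w0 wPhi];
    have [hw|hw] := leP alpha^-1 w.
- rewrite expected_value_hit// mule1 -EFinD lee_fin -[leLHS]addr0.
  rewrite lerD ?mulr_ge0 ?powR_ge0 ?exprn_ge0 ?expR_ge0//.
  by rewrite ge0_ler_powR ?nnegrE ?(le_trans w0 wPhi)// ltW.
(* At horizon 0 the error term alone suffices, as w < 1/alpha. *)
- apply: (@le_trans _ _ (0 + ((alpha^-1 `^ eta) * expR (- T^-1) ^+ 0)%:E)%E).
    rewrite add0e expr0 mulr1 lee_fin.
    by rewrite ge0_ler_powR ?nnegrE ?invr_ge0
      ?(ltW alpha_gt0) ?(ltW eta_gt0) ?(ltW hw).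
  apply: leeD => //; apply: mule_ge0; first by rewrite lee_fin powR_ge0.
  exact: expected_value_ge0.
- rewrite expected_value_hit// mule1 -EFinD lee_fin -[leLHS]addr0.
  rewrite lerD ?mulr_ge0 ?powR_ge0 ?exprn_ge0 ?expR_ge0//.
  by rewrite ge0_ler_powR ?nnegrE ?(le_trans w0 wPhi)// ltW.
- rewrite (expected_value_recr T phi_meas hP)//.
  have mV : measurable_fun setT (fun y =>
      expected_value alpha T phi P (fun _ _ => b) n s.+1 (w * phi (b, y))).
    apply: (measurableT_comp (measurable_expected_value alpha T phi_meas
      P (fun=> measurable_cst _ : measurable_fun setT (fun _ => b)) n s.+1)).
    exact: measurable_funM.
  set V := (fun y => expected_value _ _ _ _ _ n s.+1 _).
  set c := (alpha^-1 `^ eta * expR (- T^-1) ^+ n).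
  have c0 : 0 <= c by rewrite mulr_ge0 ?powR_ge0 ?exprn_ge0 ?expR_ge0.
  have V0 y : (0 <= V y)%E by exact: expected_value_ge0.
  (* Equality in the moment condition makes w^eta an exact solution of the discounted recursion. *)
  have -> : ((w `^ eta)%:E = (expR (- T^-1))%:E *
      \int[pi]_y ((w * phi (b, y)) `^ eta)%:E)%E.
    rewrite integral_scaled_moment// moment muleCA -EFinM -expRD addNr expR0.
    by rewrite mulr1.
  rewrite exprS mulrCA -/c EFinM muleCA -ge0_muleDr//; last first.
    apply: mule_ge0; first by rewrite lee_fin powR_ge0.
    by apply: integral_ge0 => y _; exact: V0.
  apply: lee_wpmul2l; first by rewrite lee_fin expR_ge0.
  (* With the error written as an integral, the claim becomes one comparison of integrands. *)
  have -> : (c%:E = \int[pi]_y c%:E)%E.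
    rewrite integral_cst// [X in (_ * X)%E](@probability_setT _ _ _ pi).
    by rewrite mule1.
  rewrite -(@ge0_integralZl_EFin _ _ _ pi setT measurableT V) ?powR_ge0//.
  rewrite -ge0_integralD//; last 2 first.
  + by move=> y _; apply: mule_ge0 => //; rewrite lee_fin powR_ge0.
  + exact: measurable_funeM.
  + apply: ae_ge0_le_integral => //.
    * by move=> y _; rewrite lee_fin powR_ge0.
    * apply/measurable_EFinP; apply: (measurableT_comp (measurable_powR eta)).
      exact: measurable_funM.
    * by move=> y _; rewrite adde_ge0 ?lee_fin// mule_ge0// lee_fin powR_ge0.
    * by apply: emeasurable_funD => //; exact: measurable_funeM.
    (* The induction hypothesis is available only where the bet pays at most [Phi]; there the new
       wealth is at most Phi times 1/alpha. *)
    * apply: filterS hPhi => y hy _; apply: IHn; rewrite mulr_ge0//=.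
      by rewrite mulrC ler_pM// ltW.
Qed.

End exponential_moment_bounds.

(** * From finite horizons to the rejection time *)

Section rejection_time_limit.
Context (R : realType) d d' (A : measurableType d) (X : measurableType d').
Variables (alpha T : R) (Valpha_gt1 : 1 < alpha^-1) (T_gt0 : 0 < T).
Variables (phi : A * X -> R) (phi_ge0 : forall z, 0 <= phi z).
Hypothesis phi_meas : measurable_fun setT phi.

Lemma iter_stail (x : seqspace X) (k i : nat) :
  iter k (@stail _ X) x i = x (k + i)%N.
Proof. by elim: k i => //= k IHk i; rewrite /stail IHk addnS. Qed.

(** Here [k] is the number of rounds left before the first hit. Starting at an arbitrary round [t]
    makes the induction possible: [truncated_value] consumes the sequence from its head, while
    [wealth] reads it from the origin. *)
Lemma truncated_value_before_hit a (x : seqspace X) (n k t : nat) :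
  (forall i, (i < t + k)%N -> wealth alpha phi a x i < alpha^-1) ->
  alpha^-1 <= wealth alpha phi a x (t + k) ->
  truncated_value alpha T phi a n t (wealth alpha phi a x t)
      (iter t (@stail _ X) x) =
    if (k <= n)%N then expR (- T^-1) ^+ k else 0.
Proof.
elim: k t n => [|k IHk] t n before hit.
  by rewrite truncated_value_hit ?expr0//; rewrite addn0 in hit.
have wt : wealth alpha phi a x t < alpha^-1.
  by apply: before; rewrite addnS ltnS leq_addr.
case: n => [|n] /=; rewrite leNgt wt//= ltnS.
have := IHk t.+1 n; rewrite addSnnS => /(_ before hit)/=.
rewrite wt iter_stail addn0 => ->.
by case: ifP; rewrite ?mulr0 ?exprS.
Qed.

Lemma truncated_value_no_hit a (x : seqspace X) (n t : nat) :
  (forall i, wealth alpha phi a x i < alpha^-1) ->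
  truncated_value alpha T phi a n t (wealth alpha phi a x t)
      (iter t (@stail _ X) x) = 0.
Proof.
move=> never; elim: n t => [|n IHn] t /=; rewrite leNgt never//=.
by have := IHn t.+1; rewrite /= never iter_stail addn0 => ->; rewrite mulr0.
Qed.

(** On each path the truncated values are stationary: from the hitting round on if there is a hit,
    and identically 0 otherwise. *)
Lemma truncated_value_eventually a (x : seqspace X) :
  exists m : nat, forall n, (m <= n)%N ->
    (truncated_value alpha T phi a n 0 1 x)%:E =
    expeR (- (rejection_time alpha phi a x * (T^-1)%:E)).
Proof.
have [hit|/forallNP never] :=
  pselect (exists t, alpha^-1 <= wealth alpha phi a x t).
  have [N hN Nmin] := ex_minnP hit.
  have before i : (i < N)%N -> wealth alpha phi a x i < alpha^-1.
    by move=> iN; rewrite ltNge; apply/negP => /Nmin; rewrite leqNgt iN.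
  (* The initial wealth 1 is below 1/alpha, so the least hitting index satisfies the condition
     [1 <= t] of [rejection_time]. *)
  have N0 : (0 < N)%N.
    rewrite lt0n; apply/eqP => N0; move: hN.
    by rewrite N0/= leNgt Valpha_gt1.
  have -> : rejection_time alpha phi a x = (N%:R)%:E.
    apply/eqP; rewrite eq_le; apply/andP; split.
      by apply: ereal_inf_lbound; exists N.
    apply: le_ereal_inf_tmp => _ [t [_ ht] <-].
    by rewrite lee_fin ler_nat; exact: Nmin.
  exists N => n Nn.
  rewrite (@truncated_value_before_hit a x n N 0)// Nn/=.
  by rewrite -expRM_natl mulrN.
exists 0%N => n _.
have never' i : wealth alpha phi a x i < alpha^-1.
  by rewrite ltNge; apply/negP/never.
have -> : rejection_time alpha phi a x = +oo%E.
  rewrite /rejection_time (_ : mkset _ = set0) ?image_set0 ?ereal_inf0//.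
  by apply/seteqP; split => t //= [_ /never].
rewrite gt0_mulye ?lte_fin ?invr_gt0//=.
by rewrite (@truncated_value_no_hit a x n 0).
Qed.

Lemma truncated_value_nondecreasing a s w (x : seqspace X) :
  {homo (fun n => truncated_value alpha T phi a n s w x) :
    m n / (m <= n)%N >-> m <= n}.
Proof.
apply: homo_leq => [//|y z t|n]; first exact: le_trans.
elim: n s w x => [|n IHn] s w x.
  by rewrite {1}/truncated_value; case: ifP => hw;
    [rewrite truncated_value_hit|exact: truncated_value_ge0].
rewrite [leLHS]/= [leRHS]/=; case: ifP => // _.
by rewrite ler_wpM2l ?expR_ge0// IHn.
Qed.

Variable P : probability (seqspace X) R.

(** Monotone convergence in the horizon. In this form, bounds uniform in [n] pass directly to the
    discounted value. *)
Lemma discounted_value_sup a : (forall t, measurable_fun setT (a t)) ->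
  discounted_value alpha phi T P a =
  ereal_sup (range (fun n => expected_value alpha T phi P a n 0 1)).
Proof.
move=> ma.
have mV n : measurable_fun setT
    (fun x => (truncated_value alpha T phi a n 0 1 x)%:E).
  by apply/measurable_EFinP; exact: measurable_truncated_value_fix.
have V0 n x : (0 <= (truncated_value alpha T phi a n 0 1 x)%:E)%E.
  by rewrite lee_fin truncated_value_ge0.
have leV x : {homo (fun n => (truncated_value alpha T phi a n 0 1 x)%:E) :
    m n / (m <= n)%N >-> (m <= n)%E}.
  by move=> m n mn; rewrite lee_fin truncated_value_nondecreasing.
transitivity (limn (fun n => expected_value alpha T phi P a n 0 1)).
  rewrite -(@monotone_convergence _ _ _ P setT measurableT _ mV)//.
  apply: eq_integral => x _; symmetry; apply/cvg_lim => //.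
  apply: cvg_near_cst; have [m hm] := truncated_value_eventually a x.
  by exists m.
apply/cvg_lim => //; apply: ereal_nondecreasing_cvgn => m n mn.
by apply: ge0_le_integral => // x _; exact: leV.
Qed.

Lemma wealth_ge0 a x t : 0 <= wealth alpha phi a x t.
Proof. by elim: t => //= t IHt; case: ifP => // _; rewrite mulr_ge0. Qed.

(* A Markov policy is measurable only on [`[0, alpha^-1[], where the wealth lies
   when it is used; the Bellman recursion wants measurability on all of [R]. *)
Definition extend_policy (a : nat -> R -> A) : nat -> R -> A :=
  fun t w => if w \in `[0, alpha^-1[ then a t w else a t 0.

Lemma measurable_extend_policy a t : markov_policy A alpha a ->
  measurable_fun setT (extend_policy a t).
Proof.
move=> ma; apply: measurable_fun_if => //.
  apply: (measurable_fun_bool true).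
  rewrite (_ : _ @^-1` _ = `[0, alpha^-1[%classic)//.
  by rewrite setTI; exact: measurable_itv.
rewrite setTI (_ : _ @^-1` _ = `[0, alpha^-1[%classic)//.
Qed.

(** The wealth is nonnegative and an action is consulted only below 1/alpha, so the two policies
    produce the same wealth paths. *)
Lemma discounted_value_extend_policy a :
  discounted_value alpha phi T P (extend_policy a) =
  discounted_value alpha phi T P a.
Proof.
have e x : wealth alpha phi (extend_policy a) x = wealth alpha phi a x.
  apply/funext => t; elim: t => //= t ->; case: ifP => // wlt.
  by rewrite /extend_policy in_itv/= wealth_ge0 wlt.
by apply: eq_integral => x _; rewrite /rejection_time e.
Qed.

End rejection_time_limit.

(** * Two auxiliary facts for the lower bound *)

Lemma moment_gt1_ae_bound (R : realType) d (X : measurableType d)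
    (pi : probability X R) (f : X -> R) (eta M : R) :
  measurable_fun setT f -> (forall y, 0 <= f y) -> 0 < eta ->
  (1 < \int[pi]_y (f y `^ eta)%:E)%E -> {ae pi, forall y, f y <= M} -> 1 <= M.
Proof.
move=> mf f0 eta0 moment hM; rewrite leNgt; apply/negP => M1.
(* If M < 1, then f^eta <= 1 almost surely, and its integral cannot exceed 1. *)
have : (\int[pi]_y (f y `^ eta)%:E <= \int[pi]_y 1%:E)%E.
  apply: ae_ge0_le_integral => //.
  - by move=> y _; rewrite lee_fin powR_ge0.
  - by apply/measurable_EFinP; exact: (measurableT_comp (measurable_powR eta)).
  - apply: filterS hM => y hy _; rewrite lee_fin.
    have -> : 1 = 1 `^ eta :> R by rewrite powR1.
    by rewrite ge0_ler_powR ?nnegrE ?(ltW eta0)// (le_trans hy (ltW M1)).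
rewrite integral_cst// [X in (_ * X)%E](@probability_setT _ _ _ pi) mule1.
by rewrite leNgt moment.
Qed.

Lemma le_of_le_add_geometric (R : realType) (x y c z : R) : 0 <= z < 1 ->
  (forall n : nat, x <= y + c * z ^+ n) -> x <= y.
Proof.
move=> /andP[z0 z1] h.
have cv : (fun n => y + c * z ^+ n) @ \oo --> y.
  rewrite -[X in _ --> X]addr0 -(mulr0 c).
  apply: cvgD; first exact: cvg_cst.
  by apply: cvgM; [exact: cvg_cst|apply: cvg_expr; rewrite ger0_norm].
rewrite -(cvg_lim _ cv)//; apply: limr_ge; first by apply/cvg_ex; exists y.
by apply: nearW.
Qed.

(** * Assembling the chain of inequalities *)

Unset Implicit Arguments.
Set Strict Implicit.

Theorem proposition3 (R : realType)
  (dX : measure_display) (X : measurableType dX) (hX : standard_borel R X)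
  (P0 : set (probability X R)) (pi1 : probability X R)
  (hpi1 : forall pi : probability X R, P0 pi ->
     ~ (forall B : set X, measurable B -> pi B = pi1 B))
  (P : probability (seqspace X) R) (hP : is_product_law pi1 P)
  (alpha : R) (halpha : 0 < alpha < 1)
  (dA : measure_display) (A : measurableType dA) (hA : standard_borel R A)
  (phi : A * X -> R) (phi_ge0 : forall z, 0 <= phi z)
  (phi_meas : measurable_fun setT phi)
  (phi_null : forall (a : A) (pi : probability X R), P0 pi ->
     (\int[pi]_x (phi (a, x))%:E <= 1)%E)
  (T : R) (hT : 0 < T)
  (astar : A) (eta : R) (heta : 0 < eta < 1)
  (hsup : ereal_sup (range (fun a : A =>
            (\int[pi1]_x (phi (a, x) `^ eta)%:E)%E)) = (expR (1 / T))%:E)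
  (hstar : (\int[pi1]_x (phi (astar, x) `^ eta)%:E)%E = (expR (1 / T))%:E)
  (Phi : R) (hPhi : {ae pi1, forall x, phi (astar, x) <= Phi}) :
  [/\ (((alpha / Phi) `^ eta)%:E
        <= discounted_value alpha phi T P (fun _ _ => astar))%E,
      (discounted_value alpha phi T P (fun _ _ => astar)
        <= ereal_sup [set discounted_value alpha phi T P a
                     | a in markov_policy A alpha])%E &
      (ereal_sup [set discounted_value alpha phi T P a
                 | a in markov_policy A alpha]
        <= (alpha `^ eta)%:E)%E].
Proof.
have /andP[alpha_gt0 alpha_lt1] := halpha.
have /andP[eta_gt0 eta_lt1] := heta.
have Valpha_gt1 : 1 < alpha^-1 by rewrite invf_gt1.
rewrite div1r in hsup hstar.
have moment b : (\int[pi1]_y (phi (b, y) `^ eta)%:E <= (expR T^-1)%:E)%E.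
  by rewrite -hsup; apply: ereal_sup_ubound; exists b.
have upper a : (forall t, measurable_fun setT (a t)) ->
    (discounted_value alpha phi T P a <= (alpha `^ eta)%:E)%E.
  move=> ma; rewrite (discounted_value_sup Valpha_gt1 hT)//.
  apply: ge_ereal_sup => _ [n _ <-].
  by rewrite -[alpha in leRHS]mulr1; apply: (expected_value_le _ _ _ hP).
have mstar : forall t : nat,
    measurable_fun setT ((fun _ _ => astar) t : R -> A).
  by move=> t; exact: measurable_cst.
split.
(* The moment e^(1/T) exceeds 1. This makes alpha/Phi meaningful and puts the initial wealth 1 below
   Phi/alpha. *)
- have Phi_ge1 : 1 <= Phi.
    apply: (moment_gt1_ae_bound _ _ eta_gt0 _ hPhi) => //.
      by apply: (measurableT_comp phi_meas); exact: pair1_measurable.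
    by rewrite hstar lte_fin expR_gt1 invr_gt0.
  have Phi_gt0 : 0 < Phi by exact: lt_le_trans Phi_ge1.
  set D := discounted_value _ _ _ _ _.
  have D_ge0 : (0 <= D)%E by apply: integral_ge0 => x _; exact: expeR_ge0.
  (* Finiteness, from the upper bound, lets the limit in [n] be taken among real numbers. *)
  have D_fin : D \is a fin_num.
    by rewrite ge0_fin_numE// (le_lt_trans (upper _ mstar))// ltry.
  have wPhi : 0 <= (1 : R) <= Phi / alpha.
    apply/andP; split => //.
    by rewrite -[leLHS]mulr1 ler_pM// ltW.
  have key : (1 : R) <= (Phi / alpha) `^ eta * fine D.
    apply: (@le_of_le_add_geometric _ _ _ (alpha^-1 `^ eta) (expR (- T^-1))).
      by rewrite expR_ge0 expR_lt1 oppr_lt0 invr_gt0.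
    move=> n; rewrite -lee_fin EFinD EFinM fineK//.
    have := expected_value_ge alpha_gt0 phi_ge0 phi_meas hP eta_gt0 n 0
      hstar hPhi wPhi.
    rewrite powR1 => /le_trans; apply; apply: leeD => //.
    apply: lee_wpmul2l; first by rewrite lee_fin powR_ge0.
    rewrite /D (discounted_value_sup Valpha_gt1 hT)//.
    by apply: ereal_sup_ubound; exists n.
  (* It remains to divide [key] by (Phi/alpha)^eta, whose inverse is (alpha/Phi)^eta. *)
  rewrite -(fineK D_fin) lee_fin.
  have K_gt0 : 0 < (Phi / alpha) `^ eta by apply: powR_gt0; exact: divr_gt0.
  rewrite -(ler_pM2l K_gt0) -powRM ?divr_ge0 ?(ltW alpha_gt0) ?(ltW Phi_gt0)//.
  rewrite (_ : Phi / alpha * (alpha / Phi) = 1) ?powR1//.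
  by rewrite mulrA divfK ?mulfV ?gt_eqF.
- by apply: ereal_sup_ubound; exists (fun _ _ => astar).
- apply: ge_ereal_sup => _ [a ma <-].
  (* [upper] needs actions measurable on the whole line, so the policy is first replaced by its
     extension. *)
  rewrite -(discounted_value_extend_policy alpha T phi_ge0).
  by apply: upper => t; exact: measurable_extend_policy.
Qed.
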